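(* The set of all pairs $(\alpha,\beta)\in\mathbb{R}^2$ with $\alpha\le 0$ and $\beta\le 0$ such that $$\lfloor \alpha \lfloor \beta x\rfloor\rfloor - \lfloor \beta \lfloor \alpha x\rfloor\rfloor \ \ge\ 0 \quad\text{for all } x\in\mathbb{R}$$ is a closed subset of $\mathbb{R}^2$.
   Context: $\lfloor x\rfloor$ denotes the floor function (largest integer $\le x$). *)

(* Defs.v *)
From HB Require Import structures.
From mathcomp Require Export all_boot all_order all_algebra.
From mathcomp Require Export all_classical all_reals all_analysis.
Export Order.TTheory GRing.Theory Num.Theory.
Export numFieldNormedType.Exports.
#[export] Set Implicit Arguments.
#[export] Unset Strict Implicit.
#[export] Unset Printing Implicit Defensive.

(* Main.v *)
Require Import Defs.
From mathcomp Require Import all_boot all_order all_algebra.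
From mathcomp Require Import all_classical all_reals all_analysis.
From mathcomp Require Import ring lra zify.
Import Order.TTheory GRing.Theory Num.Theory.
Import numFieldNormedType.Exports.
Local Open Scope classical_set_scope.
Local Open Scope ring_scope.

(** For negative [a] and [b], the commutator is negative at some point iff there
    are integers [j], [m], [n] with [b (m + 1) < a j < n <= b m].  Such a witness
    survives small perturbations of [(a, b)] unless [n = b m] and [m <> 0], in
    which case it survives only the perturbations that move [b m] upwards.
    Dirichlet approximation of [n / a] then produces a second witness
    [n' = b m'] with [m'] of the opposite sign, which survives the
    perturbations moving [b m] downwards.  Hence the complement is open. *)

(** Pigeonhole: the fractional parts of [2 * i * t] for [N + 1] indices fall into [N] cells of width
    [1 / N < e]. Even multiples force [2 <= k], so that [k - 1] is positive in
    [witness_opposite]. *)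
Lemma dirichlet_ge2 (R : realType) (t e : R) : 0 < e ->
  exists k j : int, 2 <= k /\ `|k%:~R * t - j%:~R| < e.
Proof.
move=> e0; pose N := (Num.truncn e^-1).+1.
have N0 : (0 : R) < N%:R by rewrite ltr0n.
have Ne : 1 < N%:R * e.
  by rewrite -ltr_pdivrMr // div1r truncnS_gt.
pose y (i : nat) : R := 2 * i%:R * t.
pose fr i : R := y i - (Num.floor (y i))%:~R.
have fr0 i : 0 <= fr i by rewrite subr_ge0 floor_le.
have fr1 i : fr i < 1.
  by have := floorD1_gt (y i); rewrite intrD /fr => ?; lra.
have frN i : 0 <= N%:R * fr i by rewrite mulr_ge0 // ltW.
have cellP i : (Num.truncn (N%:R * fr i) < N)%N.
  have /andP[le_cell _] := truncn_itv (frN i).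
  rewrite -(ltr_nat R); apply: le_lt_trans le_cell _.
  by rewrite -[ltRHS]mulr1 ltr_pM2l.
pose cell (i : 'I_N.+1) : 'I_N := Ordinal (cellP i).
have [i [i' [ii' cii']]] : exists i i' : 'I_N.+1, (i < i')%N /\ cell i = cell i'.
  have /injectivePn[i [i' ne eqc]] : ~~ injectiveb cell.
    apply/negP => /injectiveP/leq_card.
    by rewrite !card_ord ltnn.
  case: (ltngtP i i') => [lt|lt|eq]; first by exists i, i'.
  - by exists i', i.
  - by move: ne; rewrite (val_inj eq) eqxx.
exists (2 * (i' - i)%N%:Z), (Num.floor (y i') - Num.floor (y i)).
split; first by lia.
move: cii' => /(congr1 val) /= c.
have /andP[l1 u1] := truncn_itv (frN i).
have /andP[l2 u2] := truncn_itv (frN i').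
rewrite c in l1 u1; rewrite -natr1 in u1; rewrite -natr1 in u2.
have -> : (2 * (i' - i)%N%:Z)%:~R * t
    - (Num.floor (y i') - Num.floor (y i))%:~R = fr i' - fr i.
  rewrite intrM intrB /fr /y -pmulrn natrB; last exact: ltnW.
  ring.
(* After scaling by [N], two points of the same cell differ by less than [1 < N * e]. *)
rewrite -(ltr_pM2l N0) -[X in X * `|_|]ger0_norm ?(ltW N0) // -normrM.
apply: le_lt_trans Ne; rewrite ler_norml mulrBr; lra.
Qed.

Section Commutator.
Variable R : realType.
Implicit Types (a b : R) (p q : R * R) (j m n : int).

(** Here [j] and [m] model the floors of [b * x] and [a * x], with [x] eliminated through
    [a * b * x]; [n] separates the two outer floors. *)
Definition witness a b j m n :=
  [/\ b * (m + 1)%:~R < a * j%:~R, a * j%:~R < n%:~R & n%:~R <= b * m%:~R].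

Lemma commutator_ge0P a b : a < 0 -> b < 0 ->
  (forall x : R, Num.floor (a * (Num.floor (b * x))%:~R)
        - Num.floor (b * (Num.floor (a * x))%:~R) >= 0) <->
  ~ exists j m n, witness a b j m n.
Proof.
move=> a0 b0; split=> [ge0 [j [m [n [w1 w2 w3]]]]|nw x].
  (* At this [x] the inner floor of [b * x] is exactly [j], and [w1] says [a * x < m + 1], as
     [b < 0]. *)
  have := ge0 (j%:~R / b).
  have -> : b * (j%:~R / b) = j%:~R by field; rewrite lt_eqF.
  rewrite intrKfloor subr_ge0; apply/negP; rewrite -ltNge.
  have lt_n : Num.floor (a * j%:~R) < n by rewrite floor_lt_int.
  apply: lt_le_trans lt_n _; rewrite floor_ge_int.
  apply: le_trans w3 _; rewrite ler_nM2l // ler_int -ltzD1 floor_lt_int.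
  by rewrite mulrA ltr_ndivrMr // mulrC.
rewrite subr_ge0 leNgt; apply/negP => lt_ab; apply: nw.
exists (Num.floor (b * x)), (Num.floor (a * x)),
  (Num.floor (b * (Num.floor (a * x))%:~R)); split.
- apply: (@lt_le_trans _ _ (b * (a * x))); first by rewrite ltr_nM2l // floorD1_gt.
  by rewrite mulrCA ler_nM2l // floor_le.
- by rewrite -floor_lt_int.
- exact: floor_le.
Qed.

(** With [n = b * m] the point [a * j] lies strictly inside the interval from [n + b] to [n].
    Shifting it by [- a * i], which is nearly [- k * n], puts it inside the interval translated by
    [- k * n], whose right end is [- (k - 1) * n]. *)
Lemma witness_opposite a b j m n :
  a < 0 -> witness a b j m n -> n%:~R = b * m%:~R ->
  exists k j', 0 < k /\ witness a b j' (- k * m) (- k * n).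
Proof.
move=> a0 [w1 w2 _] nE.
rewrite intrD mulrDr mulr1 -nE in w1.
(* The distance from [a * j] to the nearer endpoint bounds the admissible error of the shift. *)
pose d := Num.min (n%:~R - a * j%:~R) (a * j%:~R - (n%:~R + b)).
have d0 : 0 < d by rewrite lt_min !subr_gt0 w1 w2.
have [|k [i [k2 approx]]] := @dirichlet_ge2 R (n%:~R / a) (d / - a).
  by rewrite divr_gt0 // oppr_gt0.
have approxM : `|k%:~R * n%:~R - a * i%:~R| < d.
  have -> : k%:~R * n%:~R - a * i%:~R = a * (k%:~R * (n%:~R / a) - i%:~R).
    by field; rewrite lt_eqF.
  by rewrite normrM ltr0_norm // mulrC -ltr_pdivlMr // oppr_gt0.
exists (k - 1), (j - i); split; first by lia.
move: approxM; rewrite /d lt_min !ltr_norml => /andP[/andP[h1 h2] /andP[h3 h4]].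
have e : b * (- (k - 1) * m)%:~R = (- (k - 1) * n)%:~R.
  by rewrite !intrM nE mulrCA.
split; last by rewrite e.
  rewrite intrD mulrDr e !(intrM, intrB, mulrNz); lra.
rewrite !(intrM, intrB, mulrNz); lra.
Qed.

Lemma near_affine_gt0 (u v w : R) p : 0 < u * p.1 + v * p.2 + w ->
  \forall q \near p, 0 < u * q.1 + v * q.2 + w.
Proof.
move=> gt0; suff cvgf : u * q.1 + v * q.2 + w @[q --> p] -->
    u * p.1 + v * p.2 + w by exact: cvgr_gt cvgf _ gt0.
apply: cvgD; last exact: cvg_cst.
by apply: cvgD; (apply: cvgM; [exact: cvg_cst|]); [exact: cvg_fst|exact: cvg_snd].
Qed.

(** Strict inequalities are open conditions; the third one may be an equality and is treated in
    [near_witness]. *)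
Lemma near_witness_lt p j m n : witness p.1 p.2 j m n ->
  \forall q \near p,
    q.2 * (m + 1)%:~R < q.1 * j%:~R /\ q.1 * j%:~R < n%:~R.
Proof.
move=> [w1 w2 _].
have n1 : \forall q \near p, 0 < j%:~R * q.1 + (- (m + 1)%:~R) * q.2 + 0.
  by apply: near_affine_gt0; lra.
have n2 : \forall q \near p, 0 < (- j%:~R) * q.1 + 0 * q.2 + n%:~R.
  by apply: near_affine_gt0; lra.
by apply: filterS2 n1 n2 => q *; split; lra.
Qed.

Lemma near_witness p : p.1 < 0 ->
  (exists j m n, witness p.1 p.2 j m n) ->
  \forall q \near p, exists j m n, witness q.1 q.2 j m n.
Proof.
move=> a0 [j [m [n w]]].
have nw := near_witness_lt w.
have [_ _] := w; rewrite le_eqVlt => /predU1P[nE|lt_n]; last first.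
  have n1 : \forall q \near p, 0 < 0 * q.1 + m%:~R * q.2 + (- n%:~R).
    by apply: near_affine_gt0; lra.
  apply: filterS2 nw n1 => q [? ?] ?; exists j, m, n; split => //; lra.
have [k [j' [k0 w']]] := witness_opposite a0 w nE.
have nw' := near_witness_lt w'.
apply: filterS2 nw nw' => q [w1 w2] [w1' w2'].
have [le_n|gt_n] := leP n%:~R (q.2 * m%:~R); first by exists j, m, n.
exists j', (- k * m), (- k * n); split=> //.
(* Multiplying [gt_n] by [- k < 0] reverses it into the missing inequality. *)
by rewrite !intrM mulrCA ler_nM2l ?ltW // mulrNz oppr_lt0 ltr0z.
Qed.

End Commutator.

Theorem theorem1p2 (R : realType) :
  closed [set p : R * R |
    [/\ p.1 <= 0, p.2 <= 0 &
      forall x : R,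
        Num.floor (p.1 * (Num.floor (p.2 * x))%:~R)
        - Num.floor (p.2 * (Num.floor (p.1 * x))%:~R) >= 0]].
Proof.
move=> p clp.
have a_le0 : p.1 <= 0.
  rewrite leNgt; apply/negP => a_gt0.
  have /clp[q [[/= q1 _ _]]] : \forall q \near p, 0 < 1 * q.1 + 0 * q.2 + 0.
    by apply: near_affine_gt0; lra.
  by rewrite /=; lra.
have b_le0 : p.2 <= 0.
  rewrite leNgt; apply/negP => b_gt0.
  have /clp[q [[/= _ q2 _]]] : \forall q \near p, 0 < 0 * q.1 + 1 * q.2 + 0.
    by apply: near_affine_gt0; lra.
  by rewrite /=; lra.
split=> //.
(* On either axis both outer floors vanish, so only strictly negative parameters remain. *)
move: a_le0; rewrite le_eqVlt => /predU1P[-> x|a_lt0].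
  by rewrite !(mul0r, floor0, mulr0, subrr).
move: b_le0; rewrite le_eqVlt => /predU1P[-> x|b_lt0].
  by rewrite !(mul0r, floor0, mulr0, subrr).
apply/commutator_ge0P => // /(near_witness a_lt0) nw.
(* The nearby [q] must also have strictly negative coordinates for [commutator_ge0P] to apply to
   it. *)
have na : \forall q \near p, 0 < (-1) * q.1 + 0 * q.2 + 0.
  by apply: near_affine_gt0; lra.
have nb : \forall q \near p, 0 < 0 * q.1 + (-1) * q.2 + 0.
  by apply: near_affine_gt0; lra.
have [q [[_ _ Sq] [[wq /= qa] /= qb]]] := clp _ (filterI (filterI nw na) nb).
by move: wq; apply: (commutator_ge0P _ _).1 Sq; lra.
Qed.
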